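(* The following identity holds, where $\ln$ denotes the natural logarithm: $$\sum_{n=1}^{\infty} \frac{1}{n(4n-1)(4n-3)} = \frac{\pi}{3}-\ln 2.$$ *)

(* Defs.v *)
From Stdlib Require Export Reals.
From Coquelicot Require Export Coquelicot.

(* Main.v *)
Require Import Defs.
From Stdlib Require Import Reals Lra Lia.
From Coquelicot Require Import Coquelicot.

Open Scope R_scope.

(** With [k = n - 1], the summand is the integral over [0,1] of [x^(4k) g x],
    where [g x = (2/3) (1 - 3 x^2 + 2 x^3)], because
    [1/(n(4n-1)(4n-3)) = (2/3)/(4n-3) - 2/(4n-1) + (4/3)/(4n)].
    Summing the geometric series, the remainder after the terms [k <= N] is the
    integral of [x^(4(N+1)) h x], where [h x = g x / (1 - x^4)] has an explicit
    primitive [H] with [H 0 = 0] and [H 1 = PI/3 - ln 2].  Since [0 <= h <= 1] on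
    [0,1], the remainder lies between [0] and [1/(4N+5)].  Integrals are
    replaced by primitives and the mean value theorem. *)

(** The factor [1 - x] is already cancelled between [(1 - x)^2 (1 + 2x)] and [1 - x^4], so [h] is
    regular at [x = 1]. *)
Definition h (x : R) : R :=
  2 / 3 * ((1 - x) * (1 + 2 * x) / ((1 + x) * (1 + x * x))).

(** From the partial fractions [(2 - x)/(1 + x^2) - 1/(1 + x)] of [h] without its factor [2/3]. *)
Definition H (x : R) : R :=
  2 / 3 * (2 * atan x - ln (1 + x) - ln (1 + x * x) / 2).

Definition term_primitive (k : nat) (x : R) : R :=
  2 / 3 * (x ^ (4 * k + 1) / INR (4 * k + 1))
  - 2 * (x ^ (4 * k + 3) / INR (4 * k + 3))
  + 4 / 3 * (x ^ (4 * k + 4) / INR (4 * k + 4)).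

Definition remainder (N : nat) (x : R) : R :=
  H x - sum_n (fun k => term_primitive k x) N.

Lemma derive_nonneg_le (f f' : R -> R) (a b : R) :
  a <= b ->
  (forall x, a <= x <= b -> is_derive f x (f' x)) ->
  (forall x, a <= x <= b -> 0 <= f' x) ->
  f a <= f b.
Proof.
  intros Hab Hd Hpos.
  destruct (MVT_gen f a b f') as [c [Hc Heq]];
    rewrite ?Rmin_left, ?Rmax_right in * by lra.
  - intros x Hx. apply Hd. lra.
  - intros x Hx. apply continuity_pt_filterlim, (ex_derive_continuous f).
    exists (f' x). now apply Hd.
  - specialize (Hpos c Hc). nra.
Qed.

Lemma h_bounds (x : R) : 0 <= x <= 1 -> 0 <= h x <= 1.
Proof.
  intros Hx. unfold h.
  assert (Hp : 0 < (1 + x) * (1 + x * x)) by nra.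
  split.
  - apply Rmult_le_pos; [lra|]. apply Rdiv_le_0_compat; [nra | exact Hp].
  - enough ((1 - x) * (1 + 2 * x) / ((1 + x) * (1 + x * x)) <= 1) by lra.
    (* Denominator minus numerator is [3 x^2 + x^3]. *)
    apply Rle_div_l; [exact Hp | nra].
Qed.

Lemma is_derive_H (x : R) : 0 <= x <= 1 -> is_derive H x (h x).
Proof.
  intros Hx. unfold H, h. auto_derive.
  - repeat split; nra.
  - unfold Rsqr. field. repeat split; nra.
Qed.

Lemma is_derive_pow_div (m : nat) (x : R) :
  is_derive (fun y => y ^ S m / INR (S m)) x (x ^ m).
Proof.
  assert (Hm : INR (S m) <> 0) by (apply not_0_INR; lia).
  auto_derive; [exact I |].
  change (Nat.pred (S m)) with m.
  change (match m with O => 1 | S _ => INR m + 1 end) with (INR (S m)).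
  field. exact Hm.
Qed.

Lemma is_derive_term_primitive (k : nat) (x : R) :
  is_derive (term_primitive k) x
    (x ^ (4 * k) * (2 / 3 * (1 - 3 * x ^ 2 + 2 * x ^ 3))).
Proof.
  replace (x ^ (4 * k) * (2 / 3 * (1 - 3 * x ^ 2 + 2 * x ^ 3)))
    with (2 / 3 * x ^ (4 * k) - 2 * x ^ (4 * k + 2) + 4 / 3 * x ^ (4 * k + 3))
    by (rewrite !pow_add; field).
  unfold term_primitive.
  rewrite <- !(Nat.add_comm 1), !Nat.add_succ_r.
  apply @is_derive_plus; [apply @is_derive_minus |];
    apply is_derive_scal;
    (* The exponent is read off the claimed derivative; the primitives then agree up to arithmetic
       in the exponents. *)
    match goal with |- is_derive _ _ (_ ^ ?m) =>
      apply (is_derive_ext (fun y => y ^ S m / INR (S m)))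
    end;
    try apply is_derive_pow_div; intros t; repeat f_equal; lia.
Qed.

(** Telescoping: subtracting term [k] removes [x^(4k) (1 - x^4) h x] from [x^(4k) h x], which raises
    the power of [x] by 4. *)
Lemma is_derive_remainder (N : nat) (x : R) :
  0 <= x <= 1 -> is_derive (remainder N) x (x ^ (4 * S N) * h x).
Proof.
  intros Hx.
  assert (Hg : 2 / 3 * (1 - 3 * x ^ 2 + 2 * x ^ 3) = (1 - x ^ 4) * h x)
    by (unfold h; field; nra).
  induction N as [|N IH].
  - apply (is_derive_ext (fun y => H y - term_primitive 0 y)).
    { intros t. unfold remainder. now rewrite sum_O. }
    replace (x ^ (4 * 1) * h x)
      with (h x - x ^ (4 * 0) * (2 / 3 * (1 - 3 * x ^ 2 + 2 * x ^ 3)))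
      by (rewrite Hg; simpl; ring).
    apply @is_derive_minus;
      [now apply is_derive_H | apply is_derive_term_primitive].
  - apply (is_derive_ext (fun y => remainder N y - term_primitive (S N) y)).
    { intros t. unfold remainder. rewrite sum_Sn. unfold plus. simpl. ring. }
    replace (x ^ (4 * S (S N)) * h x)
      with (x ^ (4 * S N) * h x
            - x ^ (4 * S N) * (2 / 3 * (1 - 3 * x ^ 2 + 2 * x ^ 3)))
      by (rewrite Hg; replace (4 * S (S N))%nat with (4 * S N + 4)%nat by lia;
          rewrite pow_add; ring).
    apply @is_derive_minus; [exact IH | apply is_derive_term_primitive].
Qed.

Lemma term_primitive_0 (k : nat) : term_primitive k 0 = 0.
Proof.
  unfold term_primitive. rewrite !pow_ne_zero by lia. unfold Rdiv. ring.
Qed.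

Lemma remainder_0 (N : nat) : remainder N 0 = 0.
Proof.
  unfold remainder, H.
  rewrite (sum_n_ext _ (fun _ => 0)) by apply term_primitive_0.
  rewrite sum_n_const, atan_0, Rmult_0_l, Rplus_0_r, ln_1. field.
Qed.

Lemma H_1 : H 1 = PI / 3 - ln 2.
Proof.
  unfold H. rewrite atan_1. replace (1 + 1 * 1) with 2 by ring.
  replace (1 + 1) with 2 by ring. field.
Qed.

Lemma term_primitive_1 (k : nat) :
  term_primitive k 1 =
  let n := INR (S k) in 1 / (n * (4 * n - 1) * (4 * n - 3)).
Proof.
  unfold term_primitive. cbv zeta.
  rewrite !pow1, S_INR, !plus_INR, mult_INR. simpl INR.
  pose proof (pos_INR k). field. lra.
Qed.

(** Two monotonicity arguments from the value 0 at [x = 0]: [h >= 0] makes [remainder N]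
    nondecreasing, and [h <= 1] does the same for [x^(m+1)/(m+1) - remainder N x] with
    [m = 4(N+1)]. *)
Lemma remainder_1_bounds (N : nat) :
  0 <= remainder N 1 <= / INR (S (4 * S N)).
Proof.
  split.
  - rewrite <- (remainder_0 N).
    apply derive_nonneg_le with (f' := fun x => x ^ (4 * S N) * h x); [lra | |].
    + apply is_derive_remainder.
    + intros x Hx. apply Rmult_le_pos; [apply pow_le; lra | now apply h_bounds].
  - set (m := (4 * S N)%nat).
    assert (Hle : 0 ^ S m / INR (S m) - remainder N 0
                  <= 1 ^ S m / INR (S m) - remainder N 1).
    { apply derive_nonneg_le with
        (f := fun x => x ^ S m / INR (S m) - remainder N x)
        (f' := fun x => x ^ m - x ^ m * h x); [lra | |].
      - intros x Hx. apply @is_derive_minus;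
          [apply is_derive_pow_div | now apply is_derive_remainder].
      - intros x Hx.
        assert (0 <= x ^ m) by (apply pow_le; lra).
        pose proof (h_bounds x Hx). nra. }
    rewrite remainder_0, pow1, pow_ne_zero in Hle by lia.
    unfold Rdiv in Hle. lra.
Qed.

(* [is_series] sums from k = 0, so the summation index is n = S k. *)
Theorem theorem1 :
  is_series
    (fun k : nat =>
       let n := INR (S k) in 1 / (n * (4 * n - 1) * (4 * n - 3)))
    (PI / 3 - ln 2).
Proof.
  apply (is_series_ext (fun k => term_primitive k 1)); [apply term_primitive_1|].
  rewrite <- H_1.
  enough (Hr : is_lim_seq (fun N => remainder N 1) 0).
  { apply (is_lim_seq_ext (fun N => H 1 - remainder N 1)
             (sum_n (fun k => term_primitive k 1)) (H 1)).
    - intros N. unfold remainder. ring.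
    - replace (Finite (H 1)) with (Finite (H 1 - 0)) by (f_equal; ring).
      apply is_lim_seq_minus'; [apply is_lim_seq_const | exact Hr]. }
  (* Squeeze with the coarser bound [1/(N+1)], a shift of the sequence [/ INR N]. *)
  apply (is_lim_seq_le_le (fun _ => 0) _ (fun N => / INR (S N))).
  - intros N. destruct (remainder_1_bounds N) as [Hlo Hhi]. split; [exact Hlo|].
    apply Rle_trans with (1 := Hhi).
    apply Rinv_le_contravar; [apply lt_0_INR | apply le_INR]; lia.
  - apply is_lim_seq_const.
  - apply (is_lim_seq_incr_1 (fun N => / INR N)).
    apply (is_lim_seq_inv _ p_infty); [apply is_lim_seq_INR | discriminate].
Qed.
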